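(* (i) For all $m\in\mathbb{Z}\setminus\{0\}$, suppose $$A_m := -\mathrm{i}\, m k A + H = R_m J_m R_m^{-1},$$ where $J_m$ is the Jordan normal form of $A_m$ and every column of $R_m$ is a unit vector. Then there exists a constant $C^{(0)}>0$ (independent of $m$) such that $$\|R_m\|_2 \leq C^{(0)}, \qquad \|R_m^{-1}\|_2 \leq C^{(0)} \qquad \text{for all } m\in\mathbb{Z}\setminus\{0\}.$$ (ii) There exists a constant $\lambda^{(0)}>0$ such that for every $m\in\mathbb{Z}\setminus\{0\}$, all the eigenvalues of $A_m$ have real parts less than $-\lambda^{(0)}$.
   Context: Let $M \geq 1$ be an integer, $D>0$ and $k = 2\pi/D$. The matrix $A$ is the real symmetric tridiagonal $(M+1)\times(M+1)$ matrix with zero diagonal whose off-diagonal entries are $A_{n,n+1}=A_{n+1,n}=\sqrt{n}$ for $n=1,\dots,M$ (rows and columns indexed from $1$ to $M+1$), all other entries being zero. The filter matrix $H = \mathrm{diag}\{h_0,h_1,\dots,h_M\}$ is a real diagonal $(M+1)\times(M+1)$ matrix with $h_i \leq 0$ for all $i$, $h_0 = 0$ and $h_M \neq 0$ (so $h_M<0$). $\|\cdot\|_2$ denotes the Euclidean norm of vectors and the induced spectral norm of matrices. *)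

(* Defs.v *)
From mathcomp Require Export all_boot all_order all_algebra.
From mathcomp Require Export complex.
From mathcomp Require Export all_classical all_reals all_analysis.

Set Implicit Arguments.
Unset Strict Implicit.
Unset Printing Implicit Defensive.

Import Order.TTheory GRing.Theory Num.Theory.

Local Open Scope classical_set_scope.
Local Open Scope ring_scope.
Local Open Scope complex_scope.

(* The canonical norm on matrices is the max norm, hence the two definitions below. *)
Definition norm2 (R : realType) (n : nat) (x : 'cV[R[i]]_n) : R :=
  Num.sqrt (\sum_(i < n) (Normc.normc (x i ord0)) ^+ 2).

Definition spectral_norm (R : realType) (m n : nat) (A : 'M[R[i]]_(m, n)) : R :=
  sup [set norm2 (A *m x) | x in [set x : 'cV[R[i]]_n | norm2 x <= 1]].

Definition jordan_block (F : fieldType) (p : nat) (lambda : F) : 'M[F]_p :=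
  \matrix_(i < p, j < p)
    (if i == j then lambda else if (i.+1 == j)%N then 1 else 0).

Definition is_jordan_form (F : fieldType) (n : nat) (J : 'M[F]_n) : Prop :=
  exists (r : nat) (p : 'I_r -> nat) (lambda : 'I_r -> F)
         (e : (\sum_(b < r) p b)%N = n),
    (forall b, (0 < p b)%N) /\
    J = castmx (e, e) (\mxdiag_(b < r) jordan_block (p b) (lambda b)).

(* Indices are 0-based here, so that the entry sqrt n in position (n, n + 1)
   becomes sqrt (i + 1) in position (i, i + 1). *)
Definition mxA (R : realType) (M : nat) : 'M[R]_(M.+1) :=
  \matrix_(i < M.+1, j < M.+1)
    (if (i.+1 == j)%N then Num.sqrt (i.+1)%:R
     else if (j.+1 == i)%N then Num.sqrt (j.+1)%:R
     else 0).

Definition mxH (R : realType) (M : nat) (h : 'I_M.+1 -> R) : 'M[R]_(M.+1) :=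
  diag_mx (\row_(i < M.+1) h i).

Definition mxAm (R : realType) (M : nat) (k : R) (h : 'I_M.+1 -> R) (m : int) :
    'M[R[i]]_(M.+1) :=
  (- 'i * m%:~R * k%:C) *: map_mx (real_complex R) (mxA R M)
  + map_mx (real_complex R) (mxH h).

(* Main.v *)
Require Import Defs.
From mathcomp Require Import perm ring lra zify.

(** Put t = m k and X = A + (i/t) H, so that A_m = -i t X and an eigenvector
    of A_m for z is an eigenvector of X for mu = i z / t.  X is tridiagonal with
    superdiagonal entries at least 1 and, for all m, |X| and |mu| are bounded by
    one constant L, so the three-term recurrence bounds every coordinate of an
    eigenvector v by a constant times |v_0|, and, run backwards, by a constant
    times |v_M|.

    (ii) Since A is symmetric, Re z |v|^2 = sum_i h_i |v_i|^2 <= h_M |v_M|^2, and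
    |v_M|^2 is at least a fixed multiple of |v|^2.

    (i) As the columns of R_m are unit vectors, it is enough to bound |det R_m|
    from below.  For |m| large, v / v_0 is real up to O(1/t), so
    |v^T v| >= |v|^2 / 2; as A_m is symmetric this rules out nontrivial Jordan
    blocks and makes R_m^T R_m diagonal with diagonal entries at least 1/2 in
    modulus.  For each of the remaining m there are finitely many Jordan forms
    J, and |det R_m| depends on J only: if R and R' both conjugate J to A_m,
    then R' R^-1 commutes with A_m, for which e_0 is a cyclic vector, hence
    R' R^-1 = p(A_m) for a polynomial p, and |p(lambda)| = 1 at every eigenvalue
    lambda because R and R' have unit columns at the start of each block. *)

Set Implicit Arguments.
Unset Strict Implicit.
Unset Printing Implicit Defensive.

Import Order.TTheory GRing.Theory Num.Theory.
Local Open Scope ring_scope.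
Local Open Scope complex_scope.

Local Notation normc := Normc.normc.

(** * Modulus, real part and imaginary part of complex numbers *)

Lemma normc_ge0 (R : rcfType) (x : R[i]) : 0 <= normc x.
Proof. by case: x => a b; exact: sqrtr_ge0. Qed.

Lemma sqr_normcE (R : rcfType) (x : R[i]) :
  normc x ^+ 2 = complex.Re x ^+ 2 + complex.Im x ^+ 2.
Proof. by case: x => a b; rewrite /= sqr_sqrtr ?addr_ge0 ?sqr_ge0. Qed.

Lemma normc_real (R : rcfType) (x : R) : normc x%:C = `|x|.
Proof. by rewrite /= expr0n addr0 sqrtr_sqr. Qed.

Lemma normcX (R : rcfType) (x : R[i]) n : normc (x ^+ n) = normc x ^+ n.
Proof.
elim: n => [|n IH]; first by rewrite !expr0 Normc.normc1.
by rewrite !exprS Normc.normcM IH.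
Qed.

Lemma normc_prod (R : rcfType) (I : Type) (r : seq I) (P : pred I)
    (F : I -> R[i]) :
  normc (\prod_(i <- r | P i) F i) = \prod_(i <- r | P i) normc (F i).
Proof.
exact: (big_morph _ (@Normc.normcM R) (Normc.normc1 R)).
Qed.

Lemma ler_normc_sum (R : rcfType) (I : Type) (r : seq I) (P : pred I)
    (F : I -> R[i]) :
  normc (\sum_(i <- r | P i) F i) <= \sum_(i <- r | P i) normc (F i).
Proof.
elim/big_ind2: _ => [|x a y b xa yb|//]; first by rewrite Normc.normc0.
exact: le_trans (le_normcD _ _) (lerD xa yb).
Qed.

Lemma Re_sum (R : rcfType) (I : Type) (r : seq I) (P : pred I) (F : I -> R[i]) :
  complex.Re (\sum_(i <- r | P i) F i) = \sum_(i <- r | P i) complex.Re (F i).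
Proof. by apply: (big_morph (@complex.Re R)) => // -[a b] [c d]. Qed.

Lemma Im_sum (R : rcfType) (I : Type) (r : seq I) (P : pred I) (F : I -> R[i]) :
  complex.Im (\sum_(i <- r | P i) F i) = \sum_(i <- r | P i) complex.Im (F i).
Proof. by apply: (big_morph (@complex.Im R)) => // -[a b] [c d]. Qed.

Lemma ImM (R : rcfType) (x y : R[i]) : complex.Im (x * y) =
  complex.Re x * complex.Im y + complex.Im x * complex.Re y.
Proof. by case: x y => a b [c d] /=. Qed.

Lemma ImB (R : rcfType) (x y : R[i]) :
  complex.Im (x - y) = complex.Im x - complex.Im y.
Proof. by case: x y => a b [c d] /=. Qed.

Lemma ler_Re_normc (R : rcfType) (x : R[i]) : `|complex.Re x| <= normc x.
Proof.
by rewrite -(ler_pXn2r (n := 2)) ?nnegrE ?normc_ge0 // sqr_normcE real_normK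
  ?num_real // lerDl sqr_ge0.
Qed.

(** * Growth of eigenvectors of Hessenberg matrices *)

Lemma discrete_gronwall (R : realFieldType) (n : nat) (a : 'I_n -> R) (t L : R) :
  0 <= L ->
  (forall i : 'I_n, a i <= t + L * \sum_(l < n | (l < i)%N) a l) ->
  forall i : 'I_n, a i <= t * (1 + L) ^+ i.
Proof.
move=> L0 Ha.
(* The claimed bound solves the recurrence with equality, so strong induction compares [a] with
   it. *)
have geo k : t + L * \sum_(l < k) t * (1 + L) ^+ l = t * (1 + L) ^+ k.
  elim: k => [|k IH]; first by rewrite big_ord0 mulr0 addr0 mulr1.
  by rewrite big_ord_recr /= mulrDr addrA IH exprS; ring.
suff H k : forall i : 'I_n, (i < k)%N -> a i <= t * (1 + L) ^+ i.
  by move=> i; exact: (H i.+1).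
elim: k => // k IH i ik; rewrite (le_trans (Ha i)) // -geo lerD2l.
apply: ler_wpM2l => //; rewrite (big_ord_widen n (fun l => t * (1 + L) ^+ l)) 1?ltnW //.
by apply: ler_sum => l li; apply: IH; exact: leq_trans li ik.
Qed.

(** Row i of B ends at column j = i + 1, so the eigenvector equation determines v_j from the earlier
    coordinates. *)
Lemma hessenberg_step (F : comPzRingType) n (B : 'M[F]_n.+1) (mu : F)
    (v : 'cV[F]_n.+1) (i j : 'I_n.+1) :
  (forall i j : 'I_n.+1, (i.+1 < j)%N -> B i j = 0) -> B *m v = mu *: v ->
  j = i.+1 :> nat ->
  B i j * v j 0 = mu * v i 0 - \sum_(l < n.+1 | (l < j)%N) B i l * v l 0.
Proof.
move=> hess Bv ij; have /matrixP/(_ i 0) := Bv; rewrite !mxE => <-.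
rewrite (bigID (fun l : 'I_n.+1 => (l < j)%N)) /= addrAC subrr add0r.
rewrite (bigD1 j) ?ltnn //= big1 ?addr0 // => l /andP[jl lj].
by rewrite hess ?mul0r // -ij ltn_neqAle eq_sym lj leqNgt.
Qed.

Lemma ord_pred_exists n (j : 'I_n.+1) : j != ord0 ->
  exists i : 'I_n.+1, j = i.+1 :> nat.
Proof.
case: j => [[|j] Hj] //= _.
by exists (Ordinal (ltnW Hj)).
Qed.

Lemma hessenberg_growth (R : rcfType) n (B : 'M[R[i]]_n.+1) (mu : R[i])
    (v : 'cV[R[i]]_n.+1) (L : R) :
  (forall i j : 'I_n.+1, (i.+1 < j)%N -> B i j = 0) ->
  (forall i j : 'I_n.+1, j = i.+1 :> nat -> 1 <= normc (B i j)) ->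
  (forall i j, normc (B i j) <= L) -> normc mu <= L -> B *m v = mu *: v ->
  forall i, normc (v i 0) <= normc (v ord0 0) * (1 + (L + L)) ^+ i.
Proof.
move=> hess sup1 BL muL Bv; have L0 := le_trans (normc_ge0 mu) muL.
apply: (discrete_gronwall (a := fun i => normc (v i 0))) => [|j].
  by rewrite addr_ge0.
have [->|/ord_pred_exists [i ij]] := eqVneq j ord0.
  by rewrite big_pred0 // mulr0 addr0.
have v0 := normc_ge0 (v ord0 0).
apply: (ler_wpDl v0).
apply: le_trans (_ : normc (B i j * v j 0) <= _).
  by rewrite Normc.normcM ler_peMl ?normc_ge0 ?sup1.
rewrite (hessenberg_step hess Bv ij) (le_trans (le_normcD _ _)) //.
(* One [L] of [L + L] pays for [mu * v i 0], the other for the entries of row i. *)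
rewrite normcN Normc.normcM mulrDl lerD //.
  rewrite (bigD1 i) /= ?ij // mulrDr ler_wpDr ?ler_wpM2r ?normc_ge0 //.
  by rewrite mulr_ge0 // sumr_ge0 // => l _; exact: normc_ge0.
rewrite (le_trans (ler_normc_sum _ _ _)) // mulr_sumr ler_sum // => l _.
by rewrite Normc.normcM ler_wpM2r ?normc_ge0.
Qed.

(** As the superdiagonal is real, the imaginary parts of v obey the same recurrence with a source
    term of order eta. One factor [K] bounds the coordinates of v in that source, the other is the
    Gronwall growth. *)
Lemma hessenberg_Im (R : rcfType) n (B : 'M[R[i]]_n.+1) (mu : R[i])
    (v : 'cV[R[i]]_n.+1) (L eta : R) :
  (forall i j : 'I_n.+1, (i.+1 < j)%N -> B i j = 0) ->
  (forall i j : 'I_n.+1, j = i.+1 :> nat -> 1 <= complex.Re (B i j)) ->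
  (forall i j : 'I_n.+1, j = i.+1 :> nat -> complex.Im (B i j) = 0) ->
  (forall i j, normc (B i j) <= L) -> normc mu <= L -> B *m v = mu *: v ->
  (forall i j, `|complex.Im (B i j)| <= eta) -> `|complex.Im mu| <= eta ->
  v ord0 0 = 1 ->
  let K := (1 + (L + L)) ^+ n in
  forall i, `|complex.Im (v i 0)| <= eta * (2 * n.+1%:R * K ^+ 2).
Proof.
move=> hess sup1 supI BL muL Bv Beta mueta v0 K i.
have L0 := le_trans (normc_ge0 mu) muL.
have K1 : 1 <= 1 + (L + L) by rewrite lerDl addr_ge0.
have vK j : normc (v j 0) <= K.
  apply: le_trans (hessenberg_growth hess _ BL muL Bv j) _ => [a b ab|].
    exact: le_trans (sup1 _ _ ab) (le_trans (ler_norm _) (ler_Re_normc _)).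
  by rewrite v0 Normc.normc1 mul1r ler_weXn2l // -ltnS.
have eta0 : 0 <= eta := le_trans (normr_ge0 _) mueta.
have K0 : 1 <= K by rewrite exprn_ege1.
have H : `|complex.Im (v i 0)| <= eta * (2 * n.+1%:R * K) * (1 + (L + L)) ^+ i.
  apply: (discrete_gronwall (a := fun i => `|complex.Im (v i 0)|)) => [|j].
    by rewrite addr_ge0.
  have t0 : 0 <= eta * (2 * n.+1%:R * K).
    by rewrite !mulr_ge0 // (le_trans ler01).
  have [->|/ord_pred_exists [k kj]] := eqVneq j ord0.
    by rewrite big_pred0 // mulr0 addr0 v0 normr0.
  have ImP (x y : R[i]) : normc x <= L -> `|complex.Im x| <= eta ->
      normc y <= K -> `|complex.Im (x * y)| <= eta * K + L * `|complex.Im y|.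
    move=> xL xe yK; rewrite ImM addrC (le_trans (ler_normD _ _)) // !normrM.
    apply: lerD; apply: ler_pM => //.
      exact: le_trans (ler_Re_normc _) yK.
    exact: le_trans (ler_Re_normc _) xL.
  apply: le_trans (_ : `|complex.Im (B k j * v j 0)| <= _).
    rewrite ImM supI // mul0r addr0 normrM ler_peMl //.
    exact: le_trans (sup1 _ _ kj) (ler_norm _).
  rewrite (hessenberg_step hess Bv kj) ImB (le_trans (ler_normB _ _)) //.
  rewrite Im_sum.
  (* One half absorbs the term in [mu], the other the at most n + 1 terms of the row sum. *)
  have -> : eta * (2 * n.+1%:R * K) = n.+1%:R * (eta * K) + n.+1%:R * (eta * K).
    by ring.
  rewrite mulrDl addrACA; apply: lerD.
    apply: le_trans (ImP _ _ muL mueta (vK k)) _; apply: lerD.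
      by rewrite ler_peMl ?ler1n // mulr_ge0 // (le_trans ler01).
    rewrite (bigD1 k) /= ?kj // mulrDr ler_wpDr // mulr_ge0 //.
    exact: sumr_ge0.
  apply: le_trans (ler_norm_sum _ _ _) _.
  apply: le_trans (_ : \sum_(l < n.+1 | (l < j)%N)
    (eta * K + L * `|complex.Im (v l 0)|) <= _); first by apply: ler_sum => l _; exact: ImP.
  rewrite big_split /= mulr_sumr lerD2r big_mkcond /=.
  apply: le_trans (_ : \sum_(l < n.+1) eta * K <= _); last first.
    by rewrite sumr_const card_ord mulr_natl.
  by apply: ler_sum => l _; case: ifP => // _; rewrite mulr_ge0 // (le_trans ler01).
apply: le_trans H _.
have -> : eta * (2 * n.+1%:R * K ^+ 2) = eta * (2 * n.+1%:R * K) * K by ring.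
apply: ler_wpM2l; first by rewrite !mulr_ge0 // (le_trans ler01).
by rewrite ler_weXn2l // -ltnS.
Qed.

(** * The cyclic vector e_0 and the commutant of a Hessenberg matrix *)

Lemma hessenberg_cyclic (F : fieldType) n (B : 'M[F]_n.+1) :
  (forall i j : 'I_n.+1, (i.+1 < j)%N -> B i j = 0) ->
  (forall i j : 'I_n.+1, j = i.+1 :> nat -> B i j != 0) ->
  forall u : 'rV[F]_n.+1, exists p, u = delta_mx 0 ord0 *m horner_mx B p.
Proof.
move=> hess sup.
pose cyc (u : 'rV[F]_n.+1) := exists p, u = delta_mx 0 ord0 *m horner_mx B p.
have cycD u w : cyc u -> cyc w -> cyc (u + w).
  by move=> [p ->] [q ->]; exists (p + q); rewrite rmorphD mulmxDr.
have cycZ a u : cyc u -> cyc (a *: u).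
  by move=> [p ->]; exists (a *: p); rewrite linearZ /= scalemxAr.
have cycB u : cyc u -> cyc (u *m B).
  by move=> [p ->]; exists (p * 'X); rewrite rmorphM /= horner_mx_X -mulmxA.
have cyc_sum (P : pred 'I_n.+1) (f : 'I_n.+1 -> 'rV[F]_n.+1) :
    (forall i, P i -> cyc (f i)) -> cyc (\sum_(i | P i) f i).
  move=> Hf; elim/big_ind: _ => //; exists 0; by rewrite rmorph0 mulmx0.
have cycE k : forall j : 'I_n.+1, (j < k)%N -> cyc (delta_mx 0 j).
  elim: k => // k IH j jk.
  have [->|/ord_pred_exists [i ij]] := eqVneq j ord0.
    by exists 1; rewrite rmorph1 mulmx1.
  (* Row i of B is e_i B and its last nonzero entry is in column j, so e_j is a combination of e_i B
     and of earlier basis vectors. *)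
  have -> : delta_mx 0 j = (B i j)^-1 *: ((delta_mx 0 i : 'rV_n.+1) *m B +
      \sum_(l < n.+1 | (l < j)%N) (- B i l) *: delta_mx 0 l).
    rewrite -[LHS]scale1r -(mulVf (sup _ _ ij)) -scalerA; congr (_ *: _).
    rewrite -rowE [row i B]row_sum_delta.
    rewrite (bigID (fun l : 'I_n.+1 => (l < j)%N)) /= addrAC -big_split /=.
    rewrite big1 ?add0r; last by move=> l _; rewrite mxE -scalerDl addrN scale0r.
    rewrite (bigD1 j) ?ltnn //= big1 ?addr0 ?mxE // => l /andP[jl lj].
    by rewrite mxE hess ?scale0r // -ij ltn_neqAle eq_sym lj leqNgt.
  apply/cycZ/cycD.
    by apply: cycB; apply: IH; rewrite -ltnS -ij.
  apply: cyc_sum => l lj; apply: cycZ; apply: IH; exact: leq_trans lj _.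
move=> u; rewrite (row_sum_delta u); apply: cyc_sum => i _.
by apply: cycZ; apply: cycE (ltnSn i).
Qed.

(** Choose p with e_0 P = e_0 p(B). Writing e_i = e_0 q(B), commutation gives e_i P = e_0 P q(B) =
    e_0 p(B) q(B) = e_i p(B). *)
Lemma hessenberg_comm_horner (F : fieldType) n (B P : 'M[F]_n.+1) :
  (forall i j : 'I_n.+1, (i.+1 < j)%N -> B i j = 0) ->
  (forall i j : 'I_n.+1, j = i.+1 :> nat -> B i j != 0) ->
  B *m P = P *m B -> exists p, P = horner_mx B p.
Proof.
move=> hess sup BP; have cyc := hessenberg_cyclic hess sup.
have [p Hp] := cyc (delta_mx 0 ord0 *m P); exists p.
apply/row_matrixP => i; rewrite !rowE.
have [q ->] := cyc (delta_mx 0 i).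
rewrite -!mulmxA (comm_horner_mx2 B q p : _ *m _ = _).
by rewrite (comm_horner_mx q BP : _ *m _ = _) mulmxA Hp -mulmxA.
Qed.

Lemma horner_mx_eigenvector (F : fieldType) n (B : 'M[F]_n.+1) (v : 'cV[F]_n.+1)
    a p :
  B *m v = a *: v -> horner_mx B p *m v = p.[a] *: v.
Proof.
move=> Bv; elim/poly_ind: p => [|p c IH].
  by rewrite rmorph0 mul0mx horner0 scale0r.
rewrite rmorphD rmorphM /= horner_mx_X horner_mx_C mulmxDl -mulmxA Bv.
by rewrite -scalemxAr IH mul_scalar_mx scalerA -scalerDl !hornerE mulrC.
Qed.

(** With e_i = e_0 p(B), the coordinate v_i is p(a) v_0. *)
Lemma hessenberg_eigenvector0 (F : fieldType) n (B : 'M[F]_n.+1)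
    (v : 'cV[F]_n.+1) a :
  (forall i j : 'I_n.+1, (i.+1 < j)%N -> B i j = 0) ->
  (forall i j : 'I_n.+1, j = i.+1 :> nat -> B i j != 0) ->
  B *m v = a *: v -> v ord0 0 = 0 -> v = 0.
Proof.
move=> hess sup Bv v0; apply/matrixP => i j; rewrite ord1 mxE.
have [p Hp] := hessenberg_cyclic hess sup (delta_mx 0 i).
have -> : v i 0 = ((delta_mx 0 i : 'rV_n.+1) *m v) 0 0 by rewrite -rowE mxE.
by rewrite Hp -mulmxA (horner_mx_eigenvector p Bv) -scalemxAr -rowE !mxE v0 mulr0.
Qed.

(** * Jordan forms described entry by entry, without block indices or casts *)

Definition jordan_like (F : fieldType) n (J : 'M[F]_n) : Prop :=
  (forall i j : 'I_n, j != i -> (j != i.+1 :> nat) -> J i j = 0) /\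
  (forall i j : 'I_n, j = i.+1 :> nat -> J i j = 0 \/ (J i j = 1 /\ J i i = J j j)).

Lemma jordan_form_like (F : fieldType) n (J : 'M[F]_n) :
  is_jordan_form J -> jordan_like J.
Proof.
move=> [r [p [lam [e [_ ->]]]]]; subst n; rewrite castmx_id.
have E (i j : 'I_(\sum_(b < r) p b)%N) : (\mxdiag_(b < r) jordan_block (p b) (lam b)) i j =
   if tagnat.sig1 i == tagnat.sig1 j then
     if i == j then lam (tagnat.sig1 i) else if (i.+1 == j)%N then 1 else 0
   else 0.
  (* An index is the rank of a pair (block, position); within one block ranks and positions differ
     by a constant, so i + 1 = j can be tested on positions. *)
  rewrite -(tagnat.sig2K i) -(tagnat.sig2K j).
  move: (tagnat.sig1 i) (tagnat.sig2 i) (tagnat.sig1 j) (tagnat.sig2 j).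
  move=> a a2 c c2; rewrite !tagnat.Rank1K.
  have -> : (\mxdiag_(b < r) jordan_block (p b) (lam b))
      (tagnat.Rank a a2) (tagnat.Rank c c2) =
      (if a == c then conform_mx 0 (jordan_block (p a) (lam a)) else 0) a2 c2.
    transitivity (submxblock (\mxdiag_(b < r) jordan_block (p b) (lam b)) a c a2 c2).
      by rewrite [RHS]mxE.
    by rewrite mxblockK.
  have [ac|ac] := eqVneq a c; last by rewrite mxE.
  subst c; rewrite conform_mx_id mxE.
  rewrite -[_ == tagnat.Rank a c2]val_eqE [val _ == _]tagnat.eq_Rank eqxx andTb.
  rewrite !tagnat.RankEsum.
  by rewrite -addnS eqn_add2l -val_eqE.
split=> i j; rewrite E.
  rewrite [j == i]eq_sym [_ == i.+1]eq_sym => /negPf -> /negPf ->.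
  by rewrite if_same.
move=> ij; rewrite !E !eqxx.
have -> : (i == j) = false by apply/eqP => e; move: ij; rewrite e => /n_Sn.
rewrite ij eqxx; by case: eqP => [->|_]; [right|left].
Qed.

Lemma horner_mx_upper_trig (F : fieldType) n (J : 'M[F]_n.+1) p :
  (forall i j : 'I_n.+1, (j < i)%N -> J i j = 0) ->
  (forall i j : 'I_n.+1, (j < i)%N -> horner_mx J p i j = 0) /\
  (forall i, horner_mx J p i i = p.[J i i]).
Proof.
move=> Ju; elim/poly_ind: p => [|p c [IHu IHd]].
  by rewrite rmorph0; split=> *; rewrite !mxE ?horner0.
have E i j : horner_mx J (p * 'X + c%:P) i j =
    (horner_mx J p *m J) i j + c *+ (i == j).
  by rewrite rmorphD rmorphM /= horner_mx_X horner_mx_C !mxE.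
split=> [i j ji|i]; rewrite E mxE.
  rewrite big1 ?add0r; first by rewrite -val_eqE gtn_eqF.
  move=> l _; have [li|il] := ltnP l i; first by rewrite IHu ?mul0r.
  by rewrite Ju ?mulr0 // (leq_trans ji).
rewrite (bigD1 i) //= big1 ?addr0 ?IHd ?hornerE ?eqxx // => l li.
have [lti|il] := ltnP l i; first by rewrite IHu ?mul0r.
by rewrite Ju ?mulr0 // ltn_neqAle il eq_sym li.
Qed.

Lemma det_upper_trig (F : fieldType) n (J : 'M[F]_n) :
  (forall i j : 'I_n, (j < i)%N -> J i j = 0) -> \det J = \prod_i J i i.
Proof.
move=> Ju; rewrite -det_tr det_trig.
  by apply: eq_bigr => i _; rewrite mxE.
by apply/is_trig_mxP => i j ij; rewrite mxE Ju.
Qed.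

Lemma jordan_like_upper (F : fieldType) n (J : 'M[F]_n) :
  jordan_like J -> forall i j : 'I_n, (j < i)%N -> J i j = 0.
Proof.
move=> [H _] i j ji; apply: H; first by rewrite -val_eqE ltn_eqF.
by rewrite ltn_eqF // ltnW.
Qed.

(** For a Jordan form, j is the first index of its block, so that e_j is an eigenvector; the
    condition is vacuous for j = 0. *)
Definition block_start (F : fieldType) n (J : 'M[F]_n) (j : 'I_n) :=
  forall i : 'I_n, j = i.+1 :> nat -> J i j = 0.

Lemma jordan_like_block_start (F : fieldType) n (J : 'M[F]_n) (j : 'I_n) :
  jordan_like J -> block_start J j -> J *m delta_mx j 0 = J j j *: (delta_mx j 0 : 'cV_n).
Proof.
move=> [J0 J1] bs; rewrite -colE; apply/matrixP => i k; rewrite ord1 !mxE eqxx andbT.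
have [->|ij] := eqVneq i j; first by rewrite mulr1.
rewrite mulr0; have [e|e] := eqVneq (j : nat) i.+1; first exact: bs.
by apply: J0 => //; rewrite eq_sym.
Qed.

(** Walk left as long as there is a 1 on the superdiagonal; the diagonal entry is constant along the
    way. *)
Lemma block_start_exists (F : fieldType) n (J : 'M[F]_n) (j : 'I_n) :
  jordan_like J -> exists2 i, block_start J i & J i i = J j j.
Proof.
move=> [J0 J1].
suff H k : forall j : 'I_n, (j <= k)%N -> exists2 i, block_start J i & J i i = J j j.
  exact: (H j).
elim: k => [|k IH] {}j jk.
  exists j => // i ji; by move: jk; rewrite ji.
have [bs|] := pselect (block_start J j); first by exists j.
move=> /existsNP [i /not_implyP [ij Jij]].
have [//|[_ e]] := J1 _ _ ij.
have [|i' bs ei] := IH i; first by rewrite -ltnS -ij.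
by exists i' => //; rewrite ei.
Qed.

(** * Determinants of Jordan bases with unit columns *)

Lemma norm2Z (R : realType) n a (x : 'cV[R[i]]_n) : norm2 (a *: x) = normc a * norm2 x.
Proof.
rewrite /norm2; under eq_bigr do rewrite mxE Normc.normcM exprMn.
by rewrite -mulr_sumr sqrtrM ?sqr_ge0 // sqrtr_sqr ger0_norm ?normc_ge0.
Qed.

(** From R2 R1^-1 = p(B) follows R2 = R1 p(J), where p(J) is triangular with diagonal entries
    p(J_jj). At a block start i, column i of R2 is p(J_ii) times that of R1, and both are unit
    vectors, so |p(J_ii)| = 1. *)
Lemma jordan_basis_det (R : realType) n (B J R1 R2 : 'M[R[i]]_n.+1) :
  (forall i j : 'I_n.+1, (i.+1 < j)%N -> B i j = 0) ->
  (forall i j : 'I_n.+1, j = i.+1 :> nat -> B i j != 0) ->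
  jordan_like J -> R1 \in unitmx -> R2 \in unitmx ->
  B = R1 *m J *m invmx R1 -> B = R2 *m J *m invmx R2 ->
  (forall j, norm2 (col j R1) = 1) -> (forall j, norm2 (col j R2) = 1) ->
  normc (\det R2) = normc (\det R1).
Proof.
move=> hess sup HJ U1 U2 B1 B2 N1 N2.
have Ju := jordan_like_upper HJ.
have [|p Hp] := @hessenberg_comm_horner _ _ B (R2 *m invmx R1) hess sup.
  by rewrite {1}B2 B1 !mulmxA !mulmxKV.
have E : R2 = R1 *m horner_mx J p.
  have : R2 *m invmx R1 *m R1 = R2 by rewrite mulmxKV.
  by rewrite Hp B1 horner_mx_uconj // mulmxKV // => <-.
have [pu pd] := horner_mx_upper_trig p Ju.
rewrite E det_mulmx Normc.normcM (det_upper_trig pu) normc_prod big1 ?mulr1 // => j _.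
rewrite pd; have [i bs <-] := block_start_exists j HJ.
have /(congr1 (col i)) := E.
rewrite (colE _ (R1 *m _)) -mulmxA (horner_mx_eigenvector p (jordan_like_block_start HJ bs)).
by rewrite -scalemxAr -colE => /(congr1 (@norm2 _ _)); rewrite norm2Z N1 N2 mulr1.
Qed.

Lemma seq_pos_bound (R : realFieldType) (T : eqType) (P : T -> R -> Prop) (s : seq T) :
  (forall x d d', P x d -> 0 < d' <= d -> P x d') ->
  (forall x, x \in s -> exists2 d, 0 < d & P x d) ->
  exists2 d, 0 < d & forall x, x \in s -> P x d.
Proof.
move=> mono; elim: s => [|x s IH] H; first by exists 1.
have [d d0 Hd] := IH (fun y ys => H y (mem_behead (s := x :: s) ys)).
have [e e0 He] := H x (mem_head _ _).
have m0 : 0 < Num.min d e by rewrite lt_min d0.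
exists (Num.min d e) => // y; rewrite inE => /predU1P [->|ys].
  by apply: mono He _; rewrite m0 ge_min lexx orbT.
by apply: mono (Hd y ys) _; rewrite m0 ge_min lexx.
Qed.

Lemma eigenvalue_of_col (F : fieldType) n (B : 'M[F]_n) (v : 'cV[F]_n) a :
  B *m v = a *: v -> v != 0 -> eigenvalue B a.
Proof.
move=> Bv; apply: contraNT.
rewrite /eigenvalue negbK /eigenspace kermx_eq0 row_free_unit => U.
by rewrite -(mulKmx U v) mulmxBl Bv mul_scalar_mx subrr mulmx0.
Qed.

Lemma jordan_basis_det_lower (R : realType) n (B : 'M[R[i]]_n.+1) :
  (forall i j : 'I_n.+1, (i.+1 < j)%N -> B i j = 0) ->
  (forall i j : 'I_n.+1, j = i.+1 :> nat -> B i j != 0) ->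
  exists2 d : R, 0 < d & forall R1 J : 'M[R[i]]_n.+1,
    R1 \in unitmx -> jordan_like J -> B = R1 *m J *m invmx R1 ->
    (forall j, norm2 (col j R1) = 1) -> d <= normc (\det R1).
Proof.
move=> hess sup.
have [s Hs] := closed_field_poly_normal (char_poly B).
(* A Jordan form of B has all its entries among 0, 1 and the roots of the characteristic polynomial,
   so it comes from one of the finitely many matrices over [T]. *)
pose T := seq_sub [:: 0, 1 & s].
pose toJ (f : 'M[T]_n.+1) := map_mx val f : 'M[R[i]]_n.+1.
pose adm (J R1 : 'M[R[i]]_n.+1) := [/\ R1 \in unitmx, jordan_like J,
  B = R1 *m J *m invmx R1 & forall j, norm2 (col j R1) = 1].
have [|f _|d d0 Hd] := @seq_pos_bound R _ (fun f d =>
    forall R1, adm (toJ f) R1 -> d <= normc (\det R1)) (enum [set: 'M[T]_n.+1]).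
- by move=> f d d' H /andP[_ dd] R1 /H; exact: le_trans.
(* One admissible basis fixes |det| for all bases with this J; if there is none, any bound holds. *)
- have [[R0 H0]|H] := pselect (exists R1, adm (toJ f) R1); last first.
    by exists 1 => // R1 a; case: H; exists R1.
  exists (normc (\det R0)) => [|R1 H1].
    rewrite lt_def normc_ge0 andbT; apply/eqP => /Normc.eq0_normc e.
    by case: H0; rewrite unitmxE e unitr0.
  case: H0 H1 => ? ? ? ? [? ? ? ?].
  by rewrite (@jordan_basis_det _ _ B (toJ f) R0 R1).
exists d => // R1 J U HJ BE N.
have Jin i j : J i j \in [:: 0, 1 & s].
  have [->|ij] := eqVneq j i.
    rewrite !inE; apply/orP; right; apply/orP; right.
    have : root (char_poly B) (J i i).
      rewrite -eigenvalue_root_char.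
      have [l bs <-] := block_start_exists i HJ.
      apply: (@eigenvalue_of_col _ _ _ (col l R1)).
        rewrite BE colE -!mulmxA mulKmx // jordan_like_block_start //.
        by rewrite -scalemxAr.
      apply/eqP => /(congr1 (@norm2 _ _)); rewrite N -[0](scale0r (0 : 'cV_n.+1)) norm2Z.
      by rewrite Normc.normc0 mul0r => /eqP; rewrite oner_eq0.
    rewrite Hs rootZ ?root_prod_XsubC //.
    by rewrite (monicP (char_poly_monic B)) oner_eq0.
  have [e|e] := eqVneq (j : nat) i.+1; last by rewrite HJ.1 // inE eqxx.
  by have [->|[-> _]] := HJ.2 _ _ e; rewrite !inE eqxx ?orbT.
have e : J = toJ (\matrix_(i, j) SeqSub (Jin i j)).
  by apply/matrixP => i j; rewrite !mxE.
apply: (Hd (\matrix_(i, j) SeqSub (Jin i j))); first by rewrite mem_enum inE.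
by rewrite -e.
Qed.

(** * Bounds on norms, determinants and inverses from bounds on the entries *)

Lemma norm2_sqr (R : realType) n (x : 'cV[R[i]]_n) :
  norm2 x ^+ 2 = \sum_i normc (x i 0) ^+ 2.
Proof. by rewrite sqr_sqrtr // sumr_ge0 // => i _; rewrite sqr_ge0. Qed.

Lemma normc_le_norm2 (R : realType) n (x : 'cV[R[i]]_n) i : normc (x i 0) <= norm2 x.
Proof.
rewrite -(ler_pXn2r (n := 2)) ?nnegrE ?normc_ge0 ?sqrtr_ge0 // norm2_sqr.
by rewrite (bigD1 i) //= lerDl sumr_ge0 // => j _; rewrite sqr_ge0.
Qed.

Lemma norm2_le_sum (R : realType) n (x : 'cV[R[i]]_n) : norm2 x <= \sum_i normc (x i 0).
Proof.
have S0 (P : pred 'I_n) : 0 <= \sum_(i | P i) normc (x i 0).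
  by rewrite sumr_ge0 // => i _; exact: normc_ge0.
rewrite -(ler_pXn2r (n := 2)) ?nnegrE ?S0 ?sqrtr_ge0 // norm2_sqr.
rewrite expr2 mulr_suml ler_sum // => i _; rewrite expr2.
by rewrite ler_wpM2l ?normc_ge0 // (bigD1 i) //= lerDl S0.
Qed.

Lemma norm20 (R : realType) n : norm2 (0 : 'cV[R[i]]_n) = 0.
Proof. by rewrite -[0](scale0r (0 : 'cV_n)) norm2Z Normc.normc0 mul0r. Qed.

Lemma spectral_norm_le (R : realType) m n (A : 'M[R[i]]_(m, n)) c :
  0 <= c -> (forall i j, normc (A i j) <= c) ->
  spectral_norm A <= m%:R * (n%:R * c).
Proof.
move=> c0 Ac; apply: ge_sup.
  by exists (norm2 (A *m 0)), 0 => //=; rewrite norm20.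
move=> _ [x /= x1 <-]; apply: le_trans (norm2_le_sum _) _.
apply: le_trans (_ : \sum_(i < m) n%:R * c <= _); last first.
  by rewrite sumr_const card_ord -[leLHS]mulr_natl.
apply: ler_sum => i _; rewrite mxE (le_trans (ler_normc_sum _ _ _)) //.
apply: le_trans (_ : \sum_(j < n) c <= _); last first.
  by rewrite sumr_const card_ord mulr_natl.
apply: ler_sum => j _; rewrite Normc.normcM -[leRHS]mulr1.
by apply: ler_pM; rewrite ?normc_ge0 ?Ac // (le_trans (normc_le_norm2 _ _)).
Qed.

Lemma normc_det_le (R : rcfType) n (A : 'M[R[i]]_n) :
  (forall i j, normc (A i j) <= 1) -> normc (\det A) <= n`!%:R.
Proof.
move=> A1; rewrite (le_trans (ler_normc_sum _ _ _)) //.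
apply: (@le_trans _ _ (\sum_(s : {perm 'I_n}) 1)); last first.
  by rewrite sumr_const ler_nat -(card_Sn n) subset_leq_card.
apply: ler_sum => s _; rewrite Normc.normcM normcX normcN Normc.normc1 expr1n mul1r.
rewrite normc_prod; apply: prodr_ile1 => i _; by rewrite normc_ge0 A1.
Qed.

(** By the cofactor formula: each cofactor is, up to sign, a determinant of size n - 1 with entries
    of modulus at most 1. *)
Lemma normc_invmx_le (R : rcfType) n (A : 'M[R[i]]_n) d :
  0 < d -> (forall i j, normc (A i j) <= 1) -> d <= normc (\det A) ->
  forall i j, normc (invmx A i j) <= d^-1 * n.-1`!%:R.
Proof.
move=> d0 A1 dA i j.
have U : A \in unitmx.
  rewrite unitmxE unitfE; apply: contraTneq dA => ->.
  by rewrite Normc.normc0 -ltNge.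
rewrite /invmx U mxE Normc.normcM Normc.normcV ler_pM ?normc_ge0 //.
- by rewrite invr_ge0 normc_ge0.
- by rewrite lef_pV2 // posrE (lt_le_trans d0).
rewrite mxE Normc.normcM normcX normcN Normc.normc1 expr1n mul1r.
by apply: normc_det_le => k l; rewrite !mxE.
Qed.

(** * Symmetric matrices with almost real eigenvectors *)

Lemma eigenvector_pairing (R : realType) n (B : 'M[R[i]]_n.+1) (mu : R[i])
    (v : 'cV[R[i]]_n.+1) (L eta : R) :
  (forall i j : 'I_n.+1, (i.+1 < j)%N -> B i j = 0) ->
  (forall i j : 'I_n.+1, j = i.+1 :> nat -> 1 <= complex.Re (B i j)) ->
  (forall i j : 'I_n.+1, j = i.+1 :> nat -> complex.Im (B i j) = 0) ->
  (forall i j, normc (B i j) <= L) -> normc mu <= L -> B *m v = mu *: v ->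
  (forall i j, `|complex.Im (B i j)| <= eta) -> `|complex.Im mu| <= eta ->
  n.+1%:R * (eta * (2 * n.+1%:R * ((1 + (L + L)) ^+ n) ^+ 2)) ^+ 2 <= 4^-1 ->
  norm2 v = 1 -> 2^-1 <= normc (\sum_i v i 0 ^+ 2).
Proof.
move=> hess sup1 supI BL muL Bv Beta mueta small v1.
have sup (i j : 'I_n.+1) : j = i.+1 :> nat -> B i j != 0.
  by move=> ij; apply: contraTneq (sup1 _ _ ij) => ->; rewrite -ltNge ltr01.
have v0 : v ord0 0 != 0.
  apply/eqP => /(hessenberg_eigenvector0 hess sup Bv) e.
  by move/eqP: v1; rewrite e norm20 eq_sym oner_eq0.
(* With first coordinate 1, q has imaginary parts at most [delta], while v and q have the same ratio
   of |v^T v| to |v|^2. *)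
pose q := (v ord0 0)^-1 *: v.
have vq : v = v ord0 0 *: q by rewrite scalerA divff // scale1r.
have Bq : B *m q = mu *: q by rewrite -scalemxAr Bv scalerA mulrC -scalerA.
have q0 : q ord0 0 = 1 by rewrite mxE mulVf.
have := hessenberg_Im hess sup1 supI BL muL Bq Beta mueta q0.
move: small; set delta := eta * _ => small /= qI.
have S : \sum_i v i 0 ^+ 2 = v ord0 0 ^+ 2 * \sum_i q i 0 ^+ 2.
  by rewrite mulr_sumr; apply: eq_bigr => i _; rewrite {1}vq mxE exprMn.
have : norm2 v ^+ 2 = 1 by rewrite v1 expr1n.
rewrite {1}vq norm2Z exprMn norm2_sqr S Normc.normcM normcX => E.
apply: (@le_trans _ _ (2^-1 * (normc (v ord0 0) ^+ 2 * \sum_i normc (q i 0) ^+ 2))).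
  by rewrite E mulr1.
rewrite mulrCA ler_wpM2l ?sqr_ge0 //.
apply: le_trans (le_trans (ler_norm _) (ler_Re_normc _)).
rewrite Re_sum.
have -> : \sum_i complex.Re (q i 0 ^+ 2) =
    \sum_i (normc (q i 0) ^+ 2) - 2 * \sum_i complex.Im (q i 0) ^+ 2.
  rewrite mulr_sumr -sumrB; apply: eq_bigr => i _.
  by rewrite sqr_normcE; case: (q i 0) => a b /=; ring.
have I2 : \sum_i complex.Im (q i 0) ^+ 2 <= 4^-1.
  apply: le_trans small; rewrite mulr_natl -[X in delta ^+ 2 *+ X]card_ord -sumr_const.
  apply: ler_sum => i _; rewrite -real_normK ?num_real //.
  by rewrite lerXn2r ?nnegrE // (le_trans _ (qI i)).
have Q1 : 1 <= \sum_i normc (q i 0) ^+ 2.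
  rewrite (bigD1 ord0) //= q0 Normc.normc1 expr1n lerDl sumr_ge0 // => i _.
  by rewrite sqr_ge0.
(* The real part is at least S - 2/4 with S = |q|^2 >= 1, hence at least S/2. *)
lra.
Qed.

Lemma mulmx_trE (F : comPzRingType) n (v w : 'cV[F]_n) :
  (v^T *m w) 0 0 = \sum_i v i 0 * w i 0.
Proof. by rewrite mxE; apply: eq_bigr => i _; rewrite mxE. Qed.

Lemma symmetric_jordan_det (R : realType) n (B R1 J : 'M[R[i]]_n.+1) :
  (forall i j : 'I_n.+1, (i.+1 < j)%N -> B i j = 0) ->
  (forall i j : 'I_n.+1, j = i.+1 :> nat -> B i j != 0) ->
  B^T = B ->
  (forall z (v : 'cV_n.+1), B *m v = z *: v -> norm2 v = 1 ->
     2^-1 <= normc (\sum_i v i 0 ^+ 2)) ->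
  R1 \in unitmx -> jordan_like J -> B = R1 *m J *m invmx R1 ->
  (forall j, norm2 (col j R1) = 1) ->
  2^-1 ^+ n.+1 <= normc (\det R1) ^+ 2.
Proof.
move=> hess sup Bsym pair U HJ BE N.
have BR : B *m R1 = R1 *m J by rewrite BE mulmxKV.
have eig j : block_start J j -> B *m col j R1 = J j j *: col j R1.
  move=> bs; rewrite colE mulmxA BR -mulmxA jordan_like_block_start //.
  by rewrite -scalemxAr.
have eigT z v : B *m v = z *: v -> v^T *m B = z *: v^T.
  by move=> /(congr1 trmx); rewrite trmx_mul Bsym linearZ.
(* A 1 above the diagonal would give B c_j = J_ii c_j + c_i for columns c_i, c_j of R1 with c_i an
   eigenvector. Pairing with c_i^T and using symmetry yields c_i^T c_i = 0, against [pair]. *)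
have bs j : block_start J j.
  suff H k : forall j : 'I_n.+1, (j <= k)%N -> block_start J j by exact: (H j).
  elim: k => [|k IH] {}j jk i ij; first by move: jk; rewrite ij.
  have ik : (i <= k)%N by rewrite -ltnS -ij.
  have [//|[Jij Jd]] := HJ.2 _ _ ij.
  have Bi := eig i (IH i ik).
  have Bj : B *m col j R1 = J i i *: col j R1 + col i R1.
    rewrite !colE mulmxA BR -mulmxA scalemxAr -mulmxDr -colE.
    congr (_ *m _); apply/matrixP => l k'; rewrite ord1 !mxE eqxx !andbT.
    have [->|lj] := eqVneq l j.
      have -> : (j == i) = false by apply/eqP => e; move: ij; rewrite e => /n_Sn.
      by rewrite mulr1 addr0 Jd.
    have [->|li] := eqVneq l i; first by rewrite mulr0 add0r.
    rewrite mulr0 add0r HJ.1 //; first by rewrite eq_sym.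
    by rewrite ij eqSS eq_sym val_eqE.
  have := pair _ _ Bi (N i).
  suff -> : \sum_l col i R1 l 0 ^+ 2 = 0.
    by rewrite Normc.normc0 leNgt invr_gt0 ltr0n.
  have : (col i R1)^T *m (B *m col j R1) = J i i *: ((col i R1)^T *m col j R1).
    by rewrite mulmxA (eigT _ _ _ Bi) -scalemxAl.
  rewrite Bj mulmxDr -scalemxAr -[RHS]addr0 => /addrI /matrixP /(_ 0 0).
  by rewrite mulmx_trE mxE.
(* For equal eigenvalues, the combination of both columns that cancels coordinate 0 is an
   eigenvector, hence zero, against the invertibility of R1. *)
have dist i j : i != j -> J i i != J j j.
  move=> ij; apply/eqP => e.
  pose a := R1 ord0 i; pose b := R1 ord0 j.
  have Ba : B *m (b *: col i R1 - a *: col j R1) = J i i *: (b *: col i R1 - a *: col j R1).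
    rewrite mulmxBr -!scalemxAr !eig // -e scalerBr !scalerA.
    by rewrite ![J i i * _]mulrC.
  have := hessenberg_eigenvector0 hess sup Ba.
  rewrite !mxE [b * _]mulrC subrr => /(_ erefl) u0.
  have : R1 *m (b *: delta_mx i 0 - a *: delta_mx j 0) = 0 :> 'cV_n.+1.
    by rewrite mulmxBr -!scalemxAr -!colE.
  move=> /(congr1 (mulmx (invmx R1))); rewrite mulKmx // mulmx0.
  move=> /matrixP /(_ j 0); rewrite !mxE !eqxx [j == i]eq_sym (negPf ij) mulr0 mulr1 sub0r.
  move=> /eqP; rewrite oppr_eq0 => /eqP a0.
  have c0 : col i R1 = 0 by apply: hessenberg_eigenvector0 hess sup (eig i (bs i)) _; rewrite mxE.
  by have /eqP := N i; rewrite c0 norm20 eq_sym oner_eq0.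
have GE i j : (R1^T *m R1) i j = ((col i R1)^T *m col j R1) 0 0.
  by rewrite mulmx_trE !mxE; apply: eq_bigr => l _; rewrite !mxE.
(* Columns for distinct eigenvalues are orthogonal for the bilinear form v^T w, so R1^T R1 is
   diagonal. *)
have G0 i j : i != j -> (R1^T *m R1) i j = 0.
  move=> ij; rewrite GE.
  have : (col i R1)^T *m (B *m col j R1) = J i i *: ((col i R1)^T *m col j R1).
    by rewrite mulmxA (eigT _ _ _ (eig i (bs i))) -scalemxAl.
  rewrite eig // -scalemxAr => /eqP; rewrite -subr_eq0 -scalerBl scaler_eq0 subr_eq0.
  by rewrite eq_sym (negPf (dist _ _ ij)) => /eqP ->; rewrite mxE.
have -> : normc (\det R1) ^+ 2 = normc (\det (R1^T *m R1)).
  by rewrite det_mulmx det_tr Normc.normcM.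
rewrite det_upper_trig; last by move=> i j ji; rewrite G0 // -val_eqE gtn_eqF.
rewrite normc_prod -[X in _ ^+ X]card_ord -prodr_const.
apply: ler_prod => i _; rewrite invr_ge0 ler0n /= GE mulmx_trE.
exact: pair (eig i (bs i)) (N i).
Qed.

(** * The matrices A_m, with a real parameter t in place of m k *)

Definition mxAt (R : realType) (M : nat) (t : R) (h : 'I_M.+1 -> R) : 'M[R[i]]_M.+1 :=
  (- 'i * t%:C) *: map_mx (real_complex R) (mxA R M)
  + map_mx (real_complex R) (mxH h).

Lemma mxAmE (R : realType) (M : nat) (k : R) (h : 'I_M.+1 -> R) (m : int) :
  mxAm k h m = mxAt (m%:~R * k) h.
Proof. by rewrite /mxAt rmorphM rmorph_int mulrA. Qed.

Lemma mxAtE (R : realType) (M : nat) (t : R) (h : 'I_M.+1 -> R) i j :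
  mxAt t h i j = (h i *+ (i == j)) -i* (t * mxA R M i j).
Proof.
have -> : mxAt t h i j =
    - 'i * t%:C * (mxA R M i j)%:C + (h i *+ (i == j))%:C.
  rewrite /mxAt mxE; congr (_ + _); first by rewrite mxE [map_mx _ _ _ _]mxE.
  by rewrite mxE [mxH h i j]mxE mxE.
by apply/eqP; rewrite eq_complex /=; apply/andP; split; apply/eqP; ring.
Qed.

Lemma mxA_hess (R : realType) (M : nat) (i j : 'I_M.+1) : (i.+1 < j)%N -> mxA R M i j = 0.
Proof.
move=> ij; rewrite mxE ltn_eqF // gtn_eqF // ltnW // ltnW //.
Qed.

Lemma mxA_sup (R : realType) (M : nat) (i j : 'I_M.+1) :
  j = i.+1 :> nat -> mxA R M i j = Num.sqrt i.+1%:R.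
Proof. by move=> ij; rewrite mxE ij eqxx. Qed.

Lemma mxA_sym (R : realType) (M : nat) (i j : 'I_M.+1) : mxA R M i j = mxA R M j i.
Proof.
rewrite !mxE; have [ij|//] := eqVneq i.+1 j.
by rewrite -ij gtn_eqF.
Qed.

(** Reversing the indices keeps the superdiagonal at least 1; this is what lets the recurrence run
    from the last coordinate. *)
Lemma mxA_rev_sup (R : realType) (M : nat) (i j : 'I_M.+1) :
  j = i.+1 :> nat -> 1 <= mxA R M (rev_ord i) (rev_ord j).
Proof.
move=> ij; rewrite mxA_sym (@mxA_sup _ _ (rev_ord j)) /=.
  by rewrite -[leLHS]sqrtr1 ler_wsqrtr // ler1n.
by rewrite ij !subSS subnSK // -ij -ltnS.
Qed.

Lemma mxAt_sym (R : realType) (M : nat) (t : R) (h : 'I_M.+1 -> R) : (mxAt t h)^T = mxAt t h.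
Proof.
apply/matrixP => i j; rewrite mxE !mxAtE mxA_sym eq_sym.
by case: eqP => // ->.
Qed.

Lemma mxAt_Re_eigenvalue (R : realType) (M : nat) (t : R) (h : 'I_M.+1 -> R) z
    (v : 'cV_M.+1) :
  mxAt t h *m v = z *: v ->
  complex.Re z * norm2 v ^+ 2 = \sum_i h i * normc (v i 0) ^+ 2.
Proof.
move=> Av; pose x i := complex.Re (v i 0); pose y i := complex.Im (v i 0).
have row i : complex.Re z * normc (v i 0) ^+ 2 = h i * normc (v i 0) ^+ 2 +
    \sum_j t * mxA R M i j * (x i * y j - y i * x j).
  have /matrixP/(_ i 0) := Av; rewrite mxE [RHS]mxE => E.
  (* This is the real part of conj(v_i) (z v_i). *)
  transitivity (x i * complex.Re (z * v i 0) + y i * complex.Im (z * v i 0)).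
    by rewrite sqr_normcE /x /y; case: (v i 0) => a b; case: z {Av E} => c d /=; ring.
  rewrite -E Re_sum Im_sum !mulr_sumr -big_split /=.
  rewrite sqr_normcE -/(x i) -/(y i).
  have -> : h i * (x i ^+ 2 + y i ^+ 2) =
      \sum_j h i *+ (i == j) * (x i * x j + y i * y j).
    rewrite (bigD1 i) //= eqxx big1 ?addr0 => [|j]; first by rewrite !expr2.
    by rewrite eq_sym => /negPf ->; rewrite mul0r.
  rewrite -big_split /=; apply: eq_bigr => j _.
  by rewrite mxAtE /x /y; case: (v i 0) (v j 0) => a b [c d] /=; ring.
rewrite norm2_sqr mulr_sumr; under eq_bigr do rewrite row.
rewrite big_split /= -[RHS]addr0; congr (_ + _).
set S := \sum_i _.
(* Exchanging i and j: A is symmetric and x_i y_j - y_i x_j is antisymmetric. *)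
have : S = - S.
  rewrite /S {1}exchange_big /= -sumrN; apply: eq_bigr => i _.
  rewrite -sumrN; apply: eq_bigr => j _; rewrite mxA_sym; ring.
by move=> ?; lra.
Qed.

(** Equal to i/t times [mxAt t h] when t is nonzero: the eigenvectors are the same, but the
    off-diagonal entries are real and independent of t, and the imaginary parts are O(1/t). *)
Definition mxX (R : realType) (M : nat) (t : R) (h : 'I_M.+1 -> R) : 'M[R[i]]_M.+1 :=
  \matrix_(i, j) (mxA R M i j +i* (t^-1 * (h i *+ (i == j)))).

Lemma mxXE (R : realType) (M : nat) (t : R) (h : 'I_M.+1 -> R) i j :
  mxX t h i j = mxA R M i j +i* (t^-1 * (h i *+ (i == j))).
Proof. by rewrite mxE. Qed.

Lemma mxX_sym (R : realType) (M : nat) (t : R) (h : 'I_M.+1 -> R) i j :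
  mxX t h i j = mxX t h j i.
Proof.
by rewrite !mxXE mxA_sym eq_sym; case: eqP => // ->.
Qed.

Lemma mxX_hess (R : realType) (M : nat) (t : R) (h : 'I_M.+1 -> R) (i j : 'I_M.+1) :
  (i.+1 < j)%N -> mxX t h i j = 0.
Proof.
move=> ij; rewrite mxXE mxA_hess // -val_eqE ltn_eqF ?mulr0 //.
exact: ltnW.
Qed.

Lemma mxX_eigenvector (R : realType) (M : nat) (t : R) (h : 'I_M.+1 -> R) z
    (v : 'cV_M.+1) :
  t != 0 -> mxAt t h *m v = z *: v ->
  mxX t h *m v = (z * 'i%C * (t^-1)%:C) *: v.
Proof.
move=> t0 Av.
have -> : mxX t h = ('i%C * (t^-1)%:C) *: mxAt t h.
  apply/matrixP => i j; rewrite mxE [RHS]mxE mxAtE.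
  apply/eqP; rewrite eq_complex /=; apply/andP; split; apply/eqP; field; exact: t0.
by rewrite -scalemxAl Av scalerA; congr (_ *: _); ring.
Qed.

(** Compare the sums of the moduli of the coordinates on both sides of B v = mu v. *)
Lemma eigenvalue_le (R : rcfType) n (B : 'M[R[i]]_n) mu (v : 'cV_n) c :
  (forall i j, normc (B i j) <= c) -> B *m v = mu *: v -> v != 0 ->
  normc mu <= n%:R * c.
Proof.
move=> Bc Bv v0.
have S0 : 0 < \sum_i normc (v i 0).
  rewrite lt_def sumr_ge0 ?andbT; last by move=> i _; exact: normc_ge0.
  apply: contra v0; rewrite psumr_eq0; last by move=> i _; exact: normc_ge0.
  move=> /allP H; apply/eqP/matrixP => i j; rewrite ord1 mxE; apply: Normc.eq0_normc.
  by apply/eqP; apply: H; rewrite mem_index_enum.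
rewrite -(ler_pM2r S0) mulr_sumr.
apply: le_trans (_ : \sum_(i < n) c * \sum_j normc (v j 0) <= _); last first.
  by rewrite sumr_const card_ord -[leLHS]mulr_natl mulrA.
apply: ler_sum => i _; rewrite -Normc.normcM.
have /matrixP/(_ i 0) := Bv; rewrite !mxE => <-.
rewrite (le_trans (ler_normc_sum _ _ _)) // mulr_sumr ler_sum // => j _.
by rewrite Normc.normcM ler_wpM2r ?normc_ge0.
Qed.

Lemma mxX_bound (R : realType) (M : nat) (h : 'I_M.+1 -> R) (e : R) : 0 <= e ->
  exists L : R, forall t, t != 0 -> `|t^-1| <= e ->
  (forall i j, normc (mxX t h i j) <= L) /\
  forall mu (v : 'cV_M.+1), v != 0 -> mxX t h *m v = mu *: v -> normc mu <= L.
Proof.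
move=> e0; pose L0 := \sum_i \sum_j `|mxA R M i j| + e * \sum_i `|h i|.
have XL0 t i j : `|t^-1| <= e -> normc (mxX t h i j) <= L0.
  move=> te; rewrite mxE (_ : _ +i* _ =
      (mxA R M i j)%:C + 'i%C * (t^-1 * (h i *+ (i == j)))%:C); last first.
    by apply/eqP; rewrite eq_complex /=; apply/andP; split; apply/eqP; ring.
  rewrite (le_trans (le_normcD _ _)) // Normc.normcM !normc_real.
  have -> : normc ('i%C : R[i]) = 1 by rewrite /= expr0n expr1n add0r sqrtr1.
  rewrite mul1r; apply: lerD.
    rewrite (bigD1 i) //= (bigD1 j) //= -addrA lerDl addr_ge0 //.
      by rewrite sumr_ge0.
    by rewrite sumr_ge0 // => ? _; rewrite sumr_ge0.
  rewrite normrM ler_pM //; apply: le_trans (_ : `|h i| <= _).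
    by case: eqP => // _; rewrite normr0.
  by rewrite (bigD1 i) //= lerDl sumr_ge0.
have L00 : 0 <= L0.
  rewrite addr_ge0 //; first by rewrite sumr_ge0 // => ? _; rewrite sumr_ge0.
  by rewrite mulr_ge0 // sumr_ge0.
exists (M.+1%:R * L0) => t t0 te; split=> [i j|mu v v0 Xv].
  by rewrite (le_trans (XL0 _ _ _ te)) // ler_peMl // ler1n.
by apply: eigenvalue_le Xv v0 => i j; exact: XL0.
Qed.

Lemma mxAt_last_coord (R : realType) (M : nat) (h : 'I_M.+1 -> R) (e : R) : 0 <= e ->
  exists2 K : R, 0 < K & forall t z (v : 'cV_M.+1), t != 0 -> `|t^-1| <= e ->
  mxAt t h *m v = z *: v -> norm2 v ^+ 2 <= K * normc (v ord_max 0) ^+ 2.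
Proof.
move=> e0; have [L HL] := mxX_bound h e0.
(* K is fixed before any t, when the sign of [L] is not known; hence the absolute values. *)
pose K := (1 + (`|L| + `|L|)) ^+ M.
have K0 : 0 < K by rewrite exprn_gt0 // ltr_wpDr // addr_ge0.
exists (M.+1%:R * K ^+ 2) => [|t z v t0 te Av]; first by rewrite mulr_gt0 // ?ltr0n // exprn_gt0.
have [->|v0] := eqVneq v 0.
  by rewrite norm20 mxE Normc.normc0 expr0n mulr0.
have [XL muL] := HL t t0 te.
have Xv := mxX_eigenvector t0 Av.
(* Reversing the order of the coordinates turns v_M into the first one; X is symmetric, so the
   reversed matrix is again Hessenberg. *)
pose w : 'cV[R[i]]_M.+1 := \col_i v (rev_ord i) 0.
pose Y : 'M[R[i]]_M.+1 := \matrix_(i, j) mxX t h (rev_ord i) (rev_ord j).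
have Yw : Y *m w = (z * 'i%C * (t^-1)%:C) *: w.
  apply/matrixP => i j; rewrite ord1 mxE [RHS]mxE [w i 0]mxE.
  have /matrixP/(_ (rev_ord i) 0) := Xv; rewrite mxE [RHS]mxE => <-.
  rewrite (reindex_inj rev_ord_inj) /=; apply: eq_bigr => l _.
  by rewrite !mxE !rev_ordK.
have grow := @hessenberg_growth R M Y _ w `|L| _ _ _ _ Yw.
have {}grow i : normc (v i 0) <= K * normc (v ord_max 0).
  have -> : v i 0 = w (rev_ord i) 0 by rewrite mxE rev_ordK.
  have -> : v ord_max 0 = w ord0 0.
    by rewrite mxE; congr (v _ _); apply: val_inj; rewrite /= subn1.
  rewrite mulrC; apply: le_trans (grow _ _ _ _ (rev_ord i)) _.
  - move=> a b ab; rewrite mxE mxX_sym mxX_hess //=.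
    by rewrite !subSS; have := ltn_ord b; lia.
  - move=> a b ab; rewrite mxE; apply: le_trans (ler_Re_normc _).
    by rewrite mxXE (le_trans _ (ler_norm _)) // mxA_rev_sup.
  - by move=> a b; rewrite mxE (le_trans (XL _ _)) // ler_norm.
  - by rewrite (le_trans (muL _ _ v0 Xv)) // ler_norm.
  rewrite ler_wpM2l ?normc_ge0 // ler_weXn2l ?lerDl ?addr_ge0 //.
  by rewrite -ltnS.
rewrite norm2_sqr -mulrA -exprMn.
apply: le_trans (_ : \sum_(i < M.+1) (K * normc (v ord_max 0)) ^+ 2 <= _).
  apply: ler_sum => i _; rewrite lerXn2r ?nnegrE ?normc_ge0 //.
  by rewrite mulr_ge0 ?normc_ge0 // ltW.
by rewrite sumr_const card_ord -[leLHS]mulr_natl.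
Qed.

Lemma mxAt_hess (R : realType) (M : nat) (t : R) (h : 'I_M.+1 -> R) (i j : 'I_M.+1) :
  (i.+1 < j)%N -> mxAt t h i j = 0.
Proof.
move=> ij; rewrite mxAtE mxA_hess // -val_eqE ltn_eqF ?mulr0 ?oppr0 //.
exact: ltnW.
Qed.

Lemma mxA_sup_ge1 (R : realType) (M : nat) (i j : 'I_M.+1) :
  j = i.+1 :> nat -> 1 <= mxA R M i j.
Proof.
by move=> ij; rewrite mxA_sup // -[leLHS]sqrtr1 ler_wsqrtr // ler1n.
Qed.

Lemma mxAt_sup (R : realType) (M : nat) (t : R) (h : 'I_M.+1 -> R) (i j : 'I_M.+1) :
  t != 0 -> j = i.+1 :> nat -> mxAt t h i j != 0.
Proof.
move=> t0 ij; rewrite mxAtE eq_complex /= negb_and oppr_eq0 mulf_eq0 (negPf t0) /=.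
by rewrite (gt_eqF (lt_le_trans ltr01 (mxA_sup_ge1 _ ij))) orbT.
Qed.

Lemma mxAt_Re_eigenvalue_le (R : realType) (M : nat) (t : R) (h : 'I_M.+1 -> R) z
    (v : 'cV_M.+1) :
  mxAt t h *m v = z *: v -> norm2 v = 1 -> `|complex.Re z| <= \sum_i `|h i|.
Proof.
move=> Av v1; have := mxAt_Re_eigenvalue Av; rewrite v1 expr1n mulr1 => ->.
apply: le_trans (ler_norm_sum _ _ _) _; apply: ler_sum => i _.
rewrite normrM ler_piMr // ger0_norm ?sqr_ge0 // expr_le1 ?normc_ge0 //.
by rewrite -v1 normc_le_norm2.
Qed.

Lemma mxAt_det_large (R : realType) (M : nat) (h : 'I_M.+1 -> R) (e : R) : 0 <= e ->
  exists T : R, forall t, t != 0 -> `|t^-1| <= e -> T <= `|t| ->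
  forall R1 J : 'M[R[i]]_M.+1, R1 \in unitmx -> jordan_like J ->
    mxAt t h = R1 *m J *m invmx R1 -> (forall j, norm2 (col j R1) = 1) ->
    2^-1 ^+ M.+1 <= normc (\det R1).
Proof.
move=> e0; have [L HL] := mxX_bound h e0.
pose C := 2 * M.+1%:R * ((1 + (L + L)) ^+ M) ^+ 2.
pose Hs := \sum_i `|h i|.
(* Beyond this threshold (M + 1) eta C <= 1/2 for eta = Hs / |t|, which gives the smallness needed
   by [eigenvector_pairing]. *)
exists (2 * M.+1%:R * (Hs * C)) => t t0 te tT R1 J U HJ BE N.
have [XL muL] := HL t t0 te.
have Hs0 : 0 <= Hs by rewrite sumr_ge0.
have C0 : 0 <= C by rewrite mulr_ge0 ?sqr_ge0 // mulr_ge0.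
pose eta := `|t^-1| * Hs.
have small : M.+1%:R * (eta * C) ^+ 2 <= 4^-1.
  have n1 : 1 <= M.+1%:R :> R by rewrite ler1n.
  have x0 : 0 <= eta * C by rewrite mulr_ge0 // mulr_ge0.
  have nx : M.+1%:R * (eta * C) <= 2^-1.
    rewrite /eta normfV -mulrA mulrCA ler_pdivrMl ?normr_gt0 //.
    by lra.
  have xx : eta * C <= 2^-1 by apply: le_trans nx; rewrite ler_peMl.
  have -> : M.+1%:R * (eta * C) ^+ 2 = M.+1%:R * (eta * C) * (eta * C) by ring.
  have -> : 4^-1 = 2^-1 * 2^-1 :> R by field.
  by apply: ler_pM => //; rewrite mulr_ge0.
have pair z (v : 'cV_M.+1) : mxAt t h *m v = z *: v -> norm2 v = 1 ->
     2^-1 <= normc (\sum_i v i 0 ^+ 2).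
  move=> Av v1; have Xv := mxX_eigenvector t0 Av.
  have v0 : v != 0.
    by apply/eqP => vz; move/eqP: v1; rewrite vz norm20 eq_sym oner_eq0.
  apply: (eigenvector_pairing _ _ _ XL (muL _ _ v0 Xv) Xv _ _ small v1).
  - by move=> i j; exact: mxX_hess.
  - by move=> i j ij; rewrite mxXE mxA_sup_ge1.
  - by move=> i j ij; rewrite mxXE /= (_ : (i == j) = false) ?mulr0 //; apply/eqP => eij; move: ij; rewrite eij => /n_Sn.
  - move=> i j; rewrite mxXE /= normrM ler_wpM2l //.
    rewrite /Hs (bigD1 i) //= ler_wpDr ?sumr_ge0 //.
    by case: eqP => // _; rewrite normr0.
  (* The imaginary part of mu is Re z / t, and |Re z| is at most [Hs]. *)
  have -> : complex.Im (z * 'i%C * (t^-1)%:C) = t^-1 * complex.Re z.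
    by case: (z) => a b /=; ring.
  by rewrite normrM ler_wpM2l // (mxAt_Re_eigenvalue_le Av).
have D := symmetric_jordan_det (@mxAt_hess _ _ t h) (fun i j => @mxAt_sup _ _ t h i j t0)
  (mxAt_sym t h) pair U HJ BE N.
(* The bound [D] is on |det R1|^2, which is at most |det R1| when the latter is at most 1. *)
have [d1|d1] := lerP (normc (\det R1)) 1.
  by apply: le_trans D _; rewrite expr2 ler_piMl ?normc_ge0.
by apply: le_trans (ltW d1); rewrite exprn_ile1 // invf_le1 // ler1n.
Qed.

(** * Bounds uniform in m, and the two claims *)

Lemma intr_mul_neq0 (R : realFieldType) (k : R) (m : int) :
  0 < k -> m != 0 -> m%:~R * k != 0.
Proof. by move=> k0 m0; apply: mulf_neq0; [rewrite intr_eq0|rewrite gt_eqF]. Qed.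

Lemma intr_mul_inv_le (R : realFieldType) (k : R) (m : int) :
  0 < k -> m != 0 -> `|(m%:~R * k)^-1| <= k^-1.
Proof.
move=> k0 m0; rewrite normfV normrM (gtr0_norm k0) lef_pV2 ?posrE //; last first.
  by rewrite mulr_gt0 // normr_gt0 intr_eq0.
by rewrite ler_peMl ?(ltW k0) // -intr_norm ler1z -gtz0_ge1 normr_gt0.
Qed.

Lemma mxAm_det_lower (R : realType) (M : nat) (k : R) (h : 'I_M.+1 -> R) : 0 < k ->
  exists2 d : R, 0 < d & forall m : int, m != 0 ->
  forall R1 J : 'M[R[i]]_M.+1, R1 \in unitmx -> jordan_like J ->
    mxAm k h m = R1 *m J *m invmx R1 -> (forall j, norm2 (col j R1) = 1) ->
    d <= normc (\det R1).
Proof.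
move=> k0.
have ki0 : 0 <= k^-1 by rewrite invr_ge0 ltW.
have [T HT] := @mxAt_det_large R M h k^-1 ki0.
(* If |m| >= N then |m k| >= T and [mxAt_det_large] applies; the finitely many other m are treated
   one by one. *)
have [N TN] : exists N : nat, T / k <= N%:R.
  exists (Num.bound `|T / k|).
  by rewrite (le_trans (ler_norm _)) // ltW // archi_boundP.
pose P (m : int) d := m != 0 -> 
  forall R1 J : 'M[R[i]]_M.+1, R1 \in unitmx -> jordan_like J ->
    mxAm k h m = R1 *m J *m invmx R1 -> (forall j, norm2 (col j R1) = 1) ->
    d <= normc (\det R1).
have [||d d0 Hd] := @seq_pos_bound R _ P
    ([seq Posz i | i <- iota 0 N] ++ [seq - Posz i | i <- iota 0 N]).
- move=> m d d' H /andP[_ dd] m0 R1 J U HJ E Nm; apply: le_trans dd _; exact: (H m0 R1 J).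
- move=> m _; have [->|m0] := eqVneq m 0; first by exists 1.
  have [|i j ij|d d0 Hd] := @jordan_basis_det_lower R M (mxAm k h m).
  + by move=> i j ij; rewrite mxAmE mxAt_hess.
  + by rewrite mxAmE mxAt_sup // intr_mul_neq0.
  by exists d => // _; exact: Hd.
exists (Num.min d (2^-1 ^+ M.+1)) => [|m m0 R1 J U HJ E Nm].
  by rewrite lt_min d0 exprn_gt0 // invr_gt0 ltr0n.
have [mN|mN] := ltnP `|m| N.
  have /Hd/(_ m0 R1 J U HJ E Nm) : m \in [seq Posz i | i <- iota 0 N] ++ [seq - Posz i | i <- iota 0 N].
    rewrite mem_cat; apply/orP; have [mp|mn] := leP 0 m.
      by left; apply/mapP; exists `|m|%N; rewrite ?mem_iota //; lia.
    by right; apply/mapP; exists `|m|%N; rewrite ?mem_iota //; lia.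
  by apply: le_trans; rewrite ge_min lexx.
rewrite mxAmE in E.
apply: le_trans (HT _ (intr_mul_neq0 k0 m0) (intr_mul_inv_le k0 m0) _ R1 J U HJ E Nm); first by rewrite ge_min lexx orbT.
rewrite normrM (gtr0_norm k0) -ler_pdivrMr // (le_trans TN) //.
by rewrite -intr_norm -abszE -pmulrn ler_nat.
Qed.

Theorem theorem2 (R : realType) (M : nat) (hM : (1 <= M)%N)
    (D : R) (hD : 0 < D) (k : R) (hk : k = 2 * pi / D)
    (h : 'I_M.+1 -> R) (h_le0 : forall i, h i <= 0)
    (h_first : h ord0 = 0) (h_last : h ord_max != 0) :
  (exists C0 : R, 0 < C0 /\
     forall m : int, m != 0 ->
     forall Rm Jm : 'M[R[i]]_(M.+1),
       Rm \in unitmx -> is_jordan_form Jm ->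
       mxAm k h m = Rm *m Jm *m invmx Rm ->
       (forall j : 'I_M.+1, norm2 (col j Rm) = 1) ->
       spectral_norm Rm <= C0 /\ spectral_norm (invmx Rm) <= C0)
  /\
  (exists lambda0 : R, 0 < lambda0 /\
     forall m : int, m != 0 ->
     forall z : R[i], eigenvalue (mxAm k h m) z -> complex.Re z < - lambda0).
Proof.
have k0 : 0 < k by rewrite hk divr_gt0 // mulr_gt0 // pi_gt0.
split.
  have [d d0 Hd] := mxAm_det_lower h k0.
  pose n : R := M.+1%:R; pose c := d^-1 * M`!%:R.
  have c0 : 0 <= c by rewrite mulr_ge0 // invr_ge0 ltW.
  have n0 : 0 < n by rewrite ltr0n.
  (* The entries of R_m are at most 1 and those of its inverse at most [c]; 1 + c dominates both. *)
  exists (n * (n * (1 + c))); split; first by rewrite !mulr_gt0 // ltr_wpDr.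
  move=> m m0 Rm Jm U /jordan_form_like HJ E N.
  have R1 i j : normc (Rm i j) <= 1.
    by rewrite -(N j) (le_trans _ (normc_le_norm2 _ i)) // mxE.
  have iR i j := normc_invmx_le d0 R1 (Hd m m0 Rm Jm U HJ E N) i j.
  have nn x : x <= 1 + c -> n * (n * x) <= n * (n * (1 + c)).
    by move=> xc; rewrite !ler_pM2l.
  split.
    by apply: le_trans (spectral_norm_le ler01 R1) (nn _ _); rewrite lerDl.
  by apply: le_trans (spectral_norm_le c0 iR) (nn _ _); rewrite lerDr.
have ki0 : 0 <= k^-1 by rewrite invr_ge0 ltW.
have [K K0 HK] := mxAt_last_coord h ki0.
have hM0 : h ord_max < 0 by rewrite lt_neqAle h_last h_le0.
(* Re z |v|^2 <= h_M |v_M|^2 and |v|^2 <= K |v_M|^2 give Re z <= h_M / K; the factor 2 makes the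
   inequality strict. *)
exists (- h ord_max / (2 * K)); split.
  by rewrite divr_gt0 ?oppr_gt0 // mulr_gt0.
move=> m m0 z /eigenvalueP [w Aw w0].
rewrite mxAmE in Aw; set t := m%:~R * k in Aw.
(* [eigenvalueP] provides a row eigenvector; symmetry allows transposing it. *)
have Av : mxAt t h *m w^T = z *: w^T.
  by rewrite -[mxAt t h]mxAt_sym -trmx_mul Aw linearZ.
have := HK _ _ _ (intr_mul_neq0 k0 m0) (intr_mul_inv_le k0 m0) Av.
have := mxAt_Re_eigenvalue Av.
set v := w^T; set V := norm2 v ^+ 2; set q := normc _ ^+ 2 => Rz Vq.
have V0 : 0 < V.
  rewrite exprn_even_gt0 //=; apply: contra w0 => /eqP v0.
  apply/eqP/matrixP => i j; rewrite ord1 mxE; apply: Normc.eq0_normc.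
  apply: le_anti; rewrite normc_ge0 andbT -v0.
  by apply: le_trans (normc_le_norm2 v j); rewrite /v mxE.
have Rle : complex.Re z * V <= h ord_max * q.
  rewrite Rz (bigD1 ord_max) //= gerDl sumr_le0 // => i _.
  by rewrite mulr_le0_ge0 ?sqr_ge0.
rewrite -(ltr_pM2r V0); apply: le_lt_trans Rle _.
have -> : - (- h ord_max / (2 * K)) * V = h ord_max * (V / (2 * K)).
  by field; rewrite gt_eqF.
rewrite ltr_nM2l // ltr_pdivrMr ?mulr_gt0 //.
have Kq0 : 0 < K * q := lt_le_trans V0 Vq.
by apply: le_lt_trans Vq _; rewrite (_ : q * (2 * K) = K * q + K * q) ?ltrDl //; ring.
Qed.
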